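(* Let $p\ge r>0$ be positive integers and let $q,s\in\mathbb{Z}$. The number of components of the twisted torus link $T(p,q;r,s)$ is a positive multiple of $\gcd(p,q,r,s)$.
   Context: For positive integers $p\ge r>0$ and integers $q,s$, the twisted torus link $T(p,q;r,s)$ is the closure of the braid on $p$ strands $(\sigma_1\sigma_2\cdots\sigma_{p-1})^q(\sigma_1\cdots\sigma_{r-1})^s$, where $\sigma_1,\dots,\sigma_{p-1}$ are the standard generators of the braid group on $p$ strands (an empty product is the trivial braid). *)

(* Defs.v *)
From mathcomp Require Import all_boot all_order all_algebra.
From mathcomp Require Import all_classical all_reals all_analysis.
Import Order.TTheory GRing.Theory Num.Theory.
Import numFieldNormedType.Exports.

Set Implicit Arguments.
Unset Strict Implicit.
Unset Printing Implicit Defensive.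

Local Open Scope classical_set_scope.
Local Open Scope ring_scope.

(* A geometric braid on p strands is represented by the union of its strands,  *)
(* a subset of [0, 1] x R^2 whose points are written (t, (x, y)).  Its ends are *)
(* the points (0, (j, 0)) and (1, (j, 0)) for 1 <= j <= p.                      *)
Definition braid_space (R : realType) : Type := (R * (R * R))%type.

Definition strands (R : realType) (p : nat) (f : nat -> R -> R * R) :
    set (braid_space R) :=
  [set z | 0 <= z.1 <= 1 /\ exists j, (1 <= j <= p)%N /\ z.2 = f j z.1].

Definition braid_id (R : realType) (p : nat) : set (braid_space R) :=
  strands p (fun j _ => (j%:R, 0)).

(* sigma_i, for 1 <= i < p: the strands i and i + 1 are exchanged, with one     *)
(* half-twist in which the y-coordinate separates them at t = 1/2.             *)
Definition braid_gen (R : realType) (p i : nat) : set (braid_space R) :=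
  strands p (fun j t =>
    if j == i then (i%:R + t, t * (1 - t))
    else if j == i.+1 then (i.+1%:R - t, - (t * (1 - t)))
    else (j%:R, 0)).

(* Stacking: A is run through on [0, 1/2], then B on [1/2, 1]. *)
Definition braid_mul (R : realType) (A B : set (braid_space R)) :
    set (braid_space R) :=
  [set z | (z.1 <= 2^-1 /\ A (2 * z.1, z.2)) \/
           (2^-1 <= z.1 /\ B (2 * z.1 - 1, z.2))].

Definition braid_inv (R : realType) (A : set (braid_space R)) :
    set (braid_space R) :=
  [set z | A (1 - z.1, z.2)].

Definition braid_pow (R : realType) (p : nat) (A : set (braid_space R))
    (k : int) : set (braid_space R) :=
  match k with
  | Posz n => iter n (braid_mul A) (@braid_id R p)
  | Negz n => iter n.+1 (braid_mul (braid_inv A)) (@braid_id R p)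
  end.

(* The ends t = 0 and t = 1 are glued by rotating the (x, y) half-plane x > 0   *)
(* once around the third coordinate axis of R^3; this is injective on           *)
(* [0, 1) x {x > 0} x R, and strands have x >= 1.                               *)
Definition close_up (R : realType) (z : braid_space R) : R * R * R :=
  (z.2.1 * cos (2 * pi * z.1), z.2.1 * sin (2 * pi * z.1), z.2.2).

Definition braid_closure (R : realType) (A : set (braid_space R)) :
    set (R * R * R) :=
  @close_up R @` A.

(* sigma_1 sigma_2 ... sigma_(n-1) as a braid on p strands *)
Definition braid_cycle (R : realType) (p n : nat) : set (braid_space R) :=
  \big[@braid_mul R / @braid_id R p]_(1 <= i < n) @braid_gen R p i.

Definition twisted_torus_link (R : realType) (p : nat) (q : int) (r : nat)
    (s : int) : set (R * R * R) :=
  braid_closure (braid_mul (braid_pow p (braid_cycle p p) q)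
                           (braid_pow p (braid_cycle p r) s)).

Definition components (T : topologicalType) (L : set T) : set (set T) :=
  [set connected_component L x | x in L].

(* Main.v *)
Require Import Defs.
From mathcomp Require Import all_boot all_order all_algebra.
From mathcomp Require Import all_classical all_reals all_analysis.
From mathcomp Require Import perm fingroup zify lra.
Import Order.TTheory GRing.Theory Num.Theory.
Import numFieldNormedType.Exports.

(* Each braid is a family of disjoint paths realizing a permutation, and the
   permutations compose under stacking.  In the closure the arcs glue along the
   cycles of the permutation w of the braid; the union of the arcs over a cycle
   is connected, compact and disjoint from the other unions, so the components
   correspond to the cycles of w.  If d divides p, q, r and s, then w acts on
   j = a d + b (0 <= b < d, strands numbered from 0) through the block index a
   only, because the d-th power of each of the two cyclic factors does.  Hence
   every residue b carries the same number of cycles. *)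

Set Implicit Arguments.
Unset Strict Implicit.
Unset Printing Implicit Defensive.

Local Open Scope classical_set_scope.
Local Open Scope ring_scope.

(** * Permutations that move blocks of length [d] and preserve residues modulo [d] *)

Definition block_perm (d p : nat) (w : 'S_p) : Prop :=
  exists phi : nat -> nat, forall x, w x = (phi (x %/ d) * d + x %% d)%N :> nat.

Section BlockPerm.
Local Open Scope nat_scope.
Variables (d p : nat) (d_gt0 : 0 < d).
Implicit Types (w v : 'S_p).

Lemma block_perm1 : block_perm d (1%g : 'S_p).
Proof. by exists id => x; rewrite perm1 -divn_eq. Qed.

Lemma block_permM w v : block_perm d w -> block_perm d v -> block_perm d (w * v)%g.
Proof.
move=> [f wE] [g vE]; exists (g \o f) => x.
by rewrite permM vE wE /= divnMDl // modnMDl modn_mod (divn_small (ltn_pmod _ _)) // addn0.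
Qed.

Lemma block_permX w k : block_perm d w -> block_perm d (w ^+ k)%g.
Proof.
move=> bw; elim: k => [|k IHk]; first by rewrite expg0; exact: block_perm1.
by rewrite expgS; exact: block_permM.
Qed.

(** In a finite group the inverse is a power, so no inverse of [phi] has to be built. *)
Lemma block_permV w : block_perm d w -> block_perm d w^-1%g.
Proof. by move=> bw; rewrite invg_expg; exact: block_permX. Qed.

Hypothesis d_dvd_p : d %| p.

(** As [d] divides [p], every block is complete and has a point of each residue [b]. *)
Lemma shift_in_block_subproof (b : 'I_d) (x : 'I_p) : x %/ d * d + b < p.
Proof.
case/dvdnP: d_dvd_p => e pE.
have x_lt : x %/ d < e by rewrite ltn_divLR // -pE.
by have := ltn_ord b; move: (x %/ d) x_lt => a; rewrite {1}pE; nia.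
Qed.

Definition shift_in_block b x : 'I_p := Ordinal (shift_in_block_subproof b x).

Lemma shift_in_block_modn b x : shift_in_block b x %% d = b.
Proof. by rewrite /= modnMDl modn_small. Qed.

Lemma shift_in_blockK b c x :
  shift_in_block c (shift_in_block b x) = shift_in_block c x.
Proof.
by apply: val_inj; rewrite /= divnMDl // (divn_small (ltn_ord b)) addn0.
Qed.

Lemma shift_in_block_id (b : 'I_d) (x : 'I_p) : x %% d = b -> shift_in_block b x = x.
Proof. by move=> xb; apply: val_inj; rewrite /= -xb -divn_eq. Qed.

Lemma block_perm_shift w b x :
  block_perm d w -> w (shift_in_block b x) = shift_in_block b (w x).
Proof.
move=> [phi wE]; apply: val_inj; rewrite /= !wE /= !divnMDl // modnMDl.
by rewrite modn_small // (divn_small (ltn_ord b)) (divn_small (ltn_pmod _ _)) // !addn0.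
Qed.

Lemma block_perm_modn w x : block_perm d w -> w x %% d = x %% d.
Proof. by case=> phi wE; rewrite wE modnMDl modn_mod. Qed.

(** Each power of [w] is again a block permutation and so commutes with the shift. *)
Lemma shift_in_block_porbit w b x : block_perm d w ->
  shift_in_block b @: porbit w x = porbit w (shift_in_block b x).
Proof.
move=> bw; have E k y := block_perm_shift b y (block_permX k bw).
apply/setP => y; apply/imsetP/porbitP => [[_ /porbitP[k ->] ->]|[k ->]].
  by exists k; rewrite E.
by exists ((w ^+ k)%g x); [rewrite mem_porbit | rewrite E].
Qed.

(* Translating the residue b of x modulo d commutes with w, so that every
   residue class carries the same number of cycles. *)
Lemma dvdn_card_porbits w : block_perm d w -> d %| #|porbits w|.
Proof.
move=> bw; pose z : 'I_d := Ordinal d_gt0.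
have modX k x : (w ^+ k)%g x %% d = x %% d := block_perm_modn x (block_permX k bw).
(* [P0] holds the cycles of residue 0, and [F] translates such a cycle to residue [b]. The rest
   shows that [F] is a bijection from pairs (cycle in [P0], residue) onto all cycles. *)
pose P0 := [set X in porbits w | [forall (x | x \in X), x %% d == 0]].
pose F (Xb : {set 'I_p} * 'I_d) := shift_in_block Xb.2 @: Xb.1.
suff -> : porbits w = F @: finset.setX P0 [set: 'I_d]%SET.
  rewrite card_in_imset; first by rewrite cardsX finset.cardsT card_ord dvdn_mull.
  have F0 X b : X \in P0 -> shift_in_block z @: F (X, b) = X.
    rewrite inE => /andP[_ /forall_inP X0]; rewrite /F -imset_comp /=.
    rewrite -[RHS]imset_id; apply: eq_in_imset => x /X0/eqP x0 /=.
    by rewrite shift_in_blockK shift_in_block_id.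
  move=> [X b] [Y c]; rewrite !finset.in_setX => /andP[XP _] /andP[YP _] XY.
  have XEY : X = Y by rewrite -(F0 X b XP) XY F0.
  congr (_, _) => //; move: XY; rewrite -{Y YP}XEY => /setP XY.
  move: XP; rewrite inE => /andP[/imsetP[x _ Xx] _].
  (* Any point of the translated cycle reveals [b] as its residue. *)
  have : shift_in_block b x \in F (X, b).
    by apply: imset_f; rewrite Xx porbit_id.
  rewrite XY => /imsetP[y _ /= E].
  by apply: ord_inj; rewrite -(shift_in_block_modn b x) E shift_in_block_modn.
apply/setP => X; apply/imsetP/imsetP => [[x _ ->]|[[Y b]]].
  pose b : 'I_d := Ordinal (ltn_pmod x d_gt0).
  exists (porbit w (shift_in_block z x), b).
    rewrite finset.in_setX !inE andbT imset_f //=.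
    by apply/forall_inP => y /porbitP[k ->]; rewrite modX shift_in_block_modn.
  by rewrite /F /= shift_in_block_porbit // shift_in_blockK shift_in_block_id.
rewrite finset.in_setX !inE => /andP[/andP[/imsetP[x _ ->] _] _] ->.
by exists (shift_in_block b x) => //; rewrite /F /= shift_in_block_porbit.
Qed.

End BlockPerm.

(** * The cyclic permutation of a factor [braid_cycle] and its powers *)

Section CyclicDecr.
Local Open Scope nat_scope.

(** Adding [n.-1] modulo [n] is subtracting 1 modulo [n], written without truncated subtraction. *)
Definition cyclic_decr p (n : nat) (c : 'S_p) : Prop :=
  forall x, c x = (if x < n then (x + n.-1) %% n else x) :> nat.

Lemma cyclic_decrX p n (c : 'S_p) k : 0 < n -> cyclic_decr n c ->
  forall x, (c ^+ k)%g x = (if x < n then (x + k * n.-1) %% n else x) :> nat.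
Proof.
move=> n_gt0 cE x; elim: k => [|k IHk].
  by rewrite perm1 mul0n addn0; case: ifP => // xn; rewrite modn_small.
rewrite expgSr permM cE IHk; case: (ltnP x n) => xn; last by rewrite ltnNge xn.
by rewrite ltn_mod n_gt0 modnDml mulSn; congr (_ %% _); lia.
Qed.

(** Below [n], the power [c ^+ d] subtracts [d] modulo [n]: it lowers the block index by 1 modulo
    [e = n / d] and keeps the residue. *)
Lemma block_perm_cyclic_decr d p n (c : 'S_p) :
  0 < d -> 0 < n -> d %| n -> cyclic_decr n c -> block_perm d (c ^+ d)%g.
Proof.
move=> d_gt0 n_gt0 /dvdnP[e nE] cE.
exists (fun a => if a < e then (a + n.-1) %% e else a) => x.
rewrite (cyclic_decrX _ n_gt0 cE) {1}nE -ltn_divLR //; case: ifP => _; last exact: divn_eq.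
have e_gt0 : 0 < e by move: n_gt0; rewrite nE; case: (e).
(* Adding [d * n.-1] advances by [n.-1] whole blocks, so [a] is the new block index before reduction
   modulo [e]. *)
set a := x %/ d + n.-1.
have -> : x + d * n.-1 = a %/ e * n + (a %% e * d + x %% d).
  rewrite {2}nE mulnA addnA -mulnDl -divn_eq /a mulnDl addnAC -divn_eq.
  by rewrite [n.-1 * d]mulnC.
rewrite modnMDl modn_small //.
have := ltn_pmod a e_gt0; have := ltn_pmod x d_gt0; rewrite [in X in _ -> _ -> X]nE; nia.
Qed.

(** The case split copies that of [braid_pow], so that the two powers correspond case by case. *)
Definition perm_zpow (p : nat) (w : 'S_p) (k : int) : 'S_p :=
  match k with Posz n => (w ^+ n)%g | Negz n => (w^-1 ^+ n.+1)%g end.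

Lemma block_perm_zpow d p n (c : 'S_p) (k : int) : 0 < d -> 0 < n ->
  d %| n -> d %| `|k|%N -> cyclic_decr n c -> block_perm d (perm_zpow c k).
Proof.
move=> d_gt0 n_gt0 dn dk cE.
suff bX m : d %| m -> block_perm d (c ^+ m)%g.
  by case: k dk => m /= dm; [exact: bX | rewrite expgVn; apply: (block_permV d_gt0); exact: bX].
case/dvdnP=> e ->; rewrite mulnC expgM; apply: (block_permX d_gt0).
exact: (block_perm_cyclic_decr d_gt0 n_gt0 dn cE).
Qed.

Lemma cyclic_decrS p n (c : 'S_p) :
  (forall x, c x = (if x < n.+1 then if x == 0 :> nat then n else x.-1 else x) :> nat) ->
  cyclic_decr n.+1 c.
Proof.
move=> cE x; rewrite cE; case: ltnP => // xn.
have [->|x0] := eqVneq (x : nat) 0; first by rewrite modn_small.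
have -> : x + n.+1.-1 = x.-1 + n.+1 by lia.
by rewrite modnDr modn_small //; lia.
Qed.

(** Counted from 0, the generator of index [i] exchanges strands [i.-1] and [i]. By induction on
    [m], the last transposition carries the image of 0 one place further and brings the new top
    point down by one. *)
Lemma cyclic_decr_prod_tperm (n m : nat) : 0 < m <= n.+1 ->
  cyclic_decr m (\prod_(1 <= i < m) tperm (inord i.-1) (inord i) : 'S_n.+1)%g.
Proof.
case: m => // m /=; rewrite ltnS => mn; apply: cyclic_decrS.
elim: m mn => [_|m IHm mn] x.
  by rewrite big_geq // perm1; case: ifP => //; case: (x : nat).
rewrite big_nat_recr //= permM /=.
move: (IHm (ltnW mn) x); set c := (\prod_(1 <= i < m.+1) _)%g; move: (c x) => y {c IHm}.
have im : (inord m : 'I_n.+1) = m :> nat by rewrite inordK // ltnW.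
have im1 : (inord m.+1 : 'I_n.+1) = m.+1 :> nat by rewrite inordK.
case: tpermP => [->|->|/eqP + /eqP]; rewrite -?val_eqE /= ?im ?im1;
  case: (ltnP x m.+1) => ?; case: (ltnP x m.+2) => ?; case: (eqVneq (x : nat) 0) => ?; lia.
Qed.

End CyclicDecr.

(** * Geometric braids and the permutations that they realize *)

Lemma pair_continuous (T U V : topologicalType) (f : T -> U) (g : T -> V) (t : T) :
  {for t, continuous f} -> {for t, continuous g} ->
  {for t, continuous (fun t => (f t, g t))}.
Proof. by move=> fc gc; exact: (cvg_pair fc gc). Qed.

Section GeometricBraids.
Variables (R : realType) (p : nat).
Implicit Types (A B : set (braid_space R)) (w v : 'S_p).

(* Strands are numbered from 0 here: strand j starts at the point (j + 1, 0). *)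
Definition braid_perm A w : Prop := exists f : 'I_p -> R -> R * R,
  [/\ forall j, continuous (f j),
      A = [set z | 0 <= z.1 <= 1 /\ exists j, z.2 = f j z.1],
      forall j, f j 0 = (j.+1%:R, 0) /\ f j 1 = ((w j).+1%:R, 0)
    & forall t, 0 <= t <= 1 -> injective (f^~ t) /\ forall j, 0 < (f j t).1].

Lemma strandsE (f : nat -> R -> R * R) : strands p f =
  [set z | 0 <= z.1 <= 1 /\ exists j : 'I_p, z.2 = f j.+1 z.1].
Proof.
apply/seteqP; split => z /= [z1 [j H]]; split => //.
  by case: j H => [|j] [/andP[// _ jp] zE]; exists (Ordinal jp).
by exists j.+1; split => //; exact: ltn_ord.
Qed.

Lemma eqn_bullet (m n : nat) : (m.+1%:R, 0) = (n.+1%:R, 0) :> R * R -> m = n.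
Proof. by case=> /eqP; rewrite eqr_nat => /eqP[]. Qed.

Lemma braid_perm_id : braid_perm (@braid_id R p) 1.
Proof.
exists (fun j _ => (j.+1%:R, 0)); split.
- by move=> j t; exact: cvg_cst.
- exact: strandsE.
- by move=> j; rewrite perm1.
- by move=> t _; split => [i j /eqn_bullet/val_inj//|j] /=; rewrite ltr0Sn.
Qed.

(** The two moving strands share their x-coordinate only at t = 1/2, where the signs of y differ. A
    moving strand has y = 0 only at its ends, which lie away from the other strands. *)
Lemma braid_perm_gen (i j : 'I_p) : j = i.+1 :> nat ->
  braid_perm (@braid_gen R p j) (tperm i j).
Proof.
move=> jE.
set g := fun (k : nat) (t : R) => if k == j then (j%:R + t, t * (1 - t))
    else if k == j.+1 then (j.+1%:R - t, - (t * (1 - t)))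
    else (k%:R, 0) : R * R.
have gi t : g i.+1 t = (j%:R + t, t * (1 - t)) by rewrite /g jE eqxx.
have gj t : g j.+1 t = (j.+1%:R - t, - (t * (1 - t))).
  by rewrite /g eqxx ifN //; lia.
have gk (k : 'I_p) t : k != i -> k != j -> g k.+1 t = (k.+1%:R, 0).
  by rewrite /g -!val_eqE /= => ki kj; rewrite !ifN //; lia.
exists (fun k => g k.+1); split.
- move=> k t.
  have c1 : {for t, continuous (fun t : R => t * (1 - t))}.
    by apply: cvgM; [exact: cvg_id|apply: cvgB; [exact: cvg_cst|exact: cvg_id]].
  rewrite /g; case: (k.+1 == j :> nat); last case: (k.+1 == j.+1 :> nat);
    rewrite /=.
  + apply: (@pair_continuous R R R (fun t => j%:R + t) _ t _ c1).
    by apply: cvgD; [exact: cvg_cst|exact: cvg_id].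
  + apply: (@pair_continuous R R R (fun t => j.+1%:R - t) _ t _ (cvgN c1)).
    by apply: cvgB; [exact: cvg_cst|exact: cvg_id].
  + exact: cvg_cst.
- exact: strandsE.
- move=> k; case: tpermP => [->|->|/eqP ki /eqP kj].
  + by rewrite !gi; split; congr (_, _); rewrite ?jE -?natr1; lra.
  + by rewrite !gj; split; congr (_, _); rewrite ?jE -?natr1; lra.
  + by rewrite !gk.
move=> t t01; split; last first.
  move=> k; have [->|ki] := eqVneq k i.
    by rewrite gi /= jE -natr1; have := ler0n R i; lra.
  have [->|kj] := eqVneq k j; last by rewrite gk //= ltr0Sn.
  by rewrite gj /= jE -!natr1; have := ler0n R i; lra.
(* Stated for any time [t']: the case [t' = 1 - t] serves the other moving strand, up to the sign of
   y. *)
have ij t' k : 0 <= t' <= 1 -> k != i -> k != j ->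
    (j%:R + t', t' * (1 - t')) = (k.+1%:R, 0) :> R * R -> False.
  move=> t'01 ki kj [E /eqP]; rewrite mulf_eq0 => /orP[]/eqP t'E; move/eqP: E.
    have -> : t' = 0 by [].
    by rewrite addr0 eqr_nat jE eqSS; apply/negP; rewrite eq_sym.
  have -> : t' = 1 by lra.
  by rewrite natr1 eqr_nat eqSS; apply/negP; rewrite eq_sym.
have inj_ij : g i.+1 t <> g j.+1 t.
  by rewrite gi gj => -[E1 E2]; move: E1; rewrite -natr1; nra.
have inj_ik k : k != i -> k != j -> g i.+1 t <> g k.+1 t.
  by move=> ki kj; rewrite gi gk //; exact: ij.
have inj_jk k : k != i -> k != j -> g j.+1 t <> g k.+1 t.
  move=> ki kj; rewrite gj gk // => -[E1 E2]; apply: (ij (1 - t) k) => //; first lra.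
  by rewrite -E1 -natr1; congr (_, _); lra.
move=> k l /=.
have [->|ki] := eqVneq k i; have [->|li] := eqVneq l i => //.
- by have [->|lj] := eqVneq l j => // /inj_ik; case.
- by have [->|kj] := eqVneq k j => /esym // /inj_ik; case.
have [->|kj] := eqVneq k j; have [->|lj] := eqVneq l j => //.
- by move/inj_jk; case.
- by move/esym/inj_jk; case.
- by rewrite !gk // => /eqn_bullet/val_inj.
Qed.

(** Strand [j] of [A] is continued by strand [w j] of [B]; this matches the product of permutations,
    which applies its left factor first. *)
Lemma braid_perm_mul A B w v :
  braid_perm A w -> braid_perm B v -> braid_perm (braid_mul A B) (w * v).
Proof.
move=> [f [fc -> fe fi]] [g [gc -> ge gi]].
(* One summand is constant on each half of [0, 1], which gives continuity at
   1/2 without a gluing argument. *)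
pose h j t := f j (Num.min (2 * t) 1) + g (w j) (Num.max (2 * t - 1) 0)
              - ((w j).+1%:R, 0).
have hl j t : t <= 2^-1 -> h j t = f j (2 * t).
  move=> t2; rewrite /h min_l; last by lra.
  by rewrite max_r; [rewrite (ge _).1 addrK | lra].
have hr j t : 2^-1 <= t -> h j t = g (w j) (2 * t - 1).
  move=> t2; rewrite /h min_r; last by lra.
  by rewrite max_l; [rewrite (fe _).2 addrAC subrr add0r | lra].
have c2 : continuous (fun t : R => 2 * t).
  by move=> t; apply: cvgM; [exact: cvg_cst|exact: cvg_id].
exists h; split.
- move=> j t; apply: cvgB; last exact: cvg_cst.
  apply: cvgD.
    apply: (@continuous_comp R R (R * R)%type (fun t => Num.min (2 * t) 1) (f j)); last exact: fc.
    by apply: (@continuous_min R R (fun t => 2 * t) (fun=> 1)); [exact: c2|exact: cvg_cst].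
  apply: (@continuous_comp R R (R * R)%type (fun t => Num.max (2 * t - 1) 0) (g (w j))); last exact: gc.
  apply: (@continuous_max R R (fun t => 2 * t - 1) (fun=> 0)); last exact: cvg_cst.
  by apply: cvgB; [exact: c2|exact: cvg_cst].
- apply/seteqP; split => -[t z] /=.
    case=> -[t2 [/= t01 [j /= ->]]]; split; try lra.
      by exists j; rewrite hl.
    (* Strand [j] of the second braid continues the strand of the first one that ends at [j]. *)
    by exists ((w^-1)%g j); rewrite hr // permKV.
  case=> t01 [j ->]; have [t2|t2] := leP t 2^-1.
    by left; split => //; split => /=; [lra|exists j; rewrite hl].
  right; split; first exact: ltW.
  by split => /=; [lra|exists (w j); rewrite hr //; exact: ltW].
- move=> j.
  have -> : h j 0 = f j 0 by rewrite hl ?mulr0 //; lra.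
  have -> : h j 1 = g (w j) 1 by rewrite hr; [congr (g _ _); lra | lra].
  by rewrite permM (fe j).1 (ge _).2.
- move=> t t01; have [t2|t2] := leP t 2^-1.
    have [|finj fpos] := fi (2 * t); first lra.
    by split => [j k /=|j]; rewrite !hl //; exact: finj.
  have [|ginj gpos] := gi (2 * t - 1); first lra.
  split => [j k /=|j]; rewrite !hr ?(ltW t2)//.
  by move/ginj/perm_inj.
Qed.

Lemma braid_perm_inv A w : braid_perm A w -> braid_perm (braid_inv A) w^-1.
Proof.
move=> [f [fc -> fe fi]].
exists (fun j t => f ((w^-1)%g j) (1 - t)); split.
- move=> j t; apply: (@continuous_comp R R (R * R)%type (fun t => 1 - t) (f _)); last exact: fc.
  by apply: cvgB; [exact: cvg_cst|exact: cvg_id].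
- apply/seteqP; split => -[t z] /= [/= t01 [j /= ->]]; (split; first by rewrite /= in t01 *; lra).
    by exists (w j); rewrite permK.
  by exists ((w^-1)%g j).
- by move=> j; rewrite subr0 subrr (fe _).1 (fe _).2 permKV.
- move=> t t01; have [|finj fpos] := fi (1 - t); first lra.
  by split => [j k /= /finj/perm_inj|j].
Qed.

Lemma braid_perm_pow A w (k : int) :
  braid_perm A w -> braid_perm (braid_pow p A k) (perm_zpow w k).
Proof.
have H B v n : braid_perm B v ->
    braid_perm (iter n (braid_mul B) (@braid_id R p)) (v ^+ n)%g.
  move=> bv; elim: n => [|n IHn]; first exact: braid_perm_id.
  by rewrite iterS expgS; exact: braid_perm_mul.
by move=> bw; case: k => n; apply: H => //; exact: braid_perm_inv.
Qed.

End GeometricBraids.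

Lemma braid_perm_cycle (R : realType) (n m : nat) : (m <= n.+1)%N ->
  braid_perm (@braid_cycle R n.+1 m)
    (\prod_(1 <= i < m) tperm (inord i.-1) (inord i) : 'S_n.+1)%g.
Proof.
move=> mn; rewrite /braid_cycle big_nat_cond [X in braid_perm _ X]big_nat_cond.
apply: (big_rec2 (fun A w => braid_perm A w)); first exact: braid_perm_id.
move=> i A w; rewrite andbT => /andP[i_gt0 im] Aw; apply: braid_perm_mul => //.
have iE : (inord i : 'I_n.+1) = i :> nat by rewrite inordK //; lia.
rewrite -{1}iE; apply: braid_perm_gen; rewrite iE inordK; lia.
Qed.

(** * The gluing map of the closure *)

(** These are cylindrical coordinates: the positive radius is recovered from its square, and the
    angle determines the time modulo 1. *)
Lemma close_up_eq (R : realType) (z z' : braid_space R) :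
  0 <= z.1 <= 1 -> 0 <= z'.1 <= 1 -> 0 < z.2.1 -> 0 < z'.2.1 ->
  close_up z = close_up z' ->
  z.2 = z'.2 /\ (z.1 = z'.1 \/ [/\ z.1 = 0 & z'.1 = 1] \/ [/\ z.1 = 1 & z'.1 = 0]).
Proof.
case: z => [t [x y]]; case: z' => [u [x' y']] /= t01 u01 x0 x'0.
rewrite /close_up /= => -[]; set a := 2 * pi * t; set b := 2 * pi * u => ec es ->.
have ca := cos2Dsin2 a; have cb := cos2Dsin2 b.
have xx' : x = x'.
  have : x ^+ 2 = x' ^+ 2.
    rewrite -[LHS]mulr1 -ca -[RHS]mulr1 -cb !mulrDr -!exprMn ec es //.
  by move/eqP; rewrite eqrXn2 ?ltW // => /eqP.
split; first by rewrite xx'.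
move: ec es; rewrite xx' => /(mulfI (lt0r_neq0 x'0)) ec /(mulfI (lt0r_neq0 x'0)) es.
have cab : cos (a - b) = 1 by rewrite cosB ec es -!expr2.
(* Halving the angle helps because [sin (pi * s)] has no zero for 0 < s < 1, so [t - u] can only be
   0, 1 or -1. *)
have sab : sin (pi * (t - u)) = 0.
  have : cos ((pi * (t - u)) *+ 2) = 1.
    by rewrite -cab; congr cos; rewrite /a /b -mulr_natl; lra.
  rewrite cos_mulr2n cos2sin2 => E; apply/eqP; rewrite -sqrf_eq0; apply/eqP; lra.
have pi0 := pi_gt0 R.
have sin_neq0 (s : R) : 0 < s < 1 -> sin (pi * s) <> 0.
  move=> /andP[s0 s1]; apply/eqP; rewrite gt_eqF // sin_gt0_pi //.
  by apply/andP; split; nra.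
have [tu|tu|->] := ltgtP t u; last by left.
- right; left; have [u1|u1] := ltP (u - t) 1; last by split; lra.
  case: (sin_neq0 (u - t)); first lra.
  by rewrite -opprB mulrN sinN sab oppr0.
- right; right; have [u1|u1] := ltP (t - u) 1; last by split; lra.
  by case: (sin_neq0 (t - u)); first lra.
Qed.

Lemma close_up_continuous (R : realType) (f : R -> R * R) :
  continuous f -> continuous (fun t => close_up (t, f t)).
Proof.
move=> fc t; rewrite /close_up.
have f1 : {for t, continuous (fun t => (f t).1)}.
  by apply: continuous_comp; [exact: fc|exact: cvg_fst].
have f2 : {for t, continuous (fun t => (f t).2)}.
  by apply: continuous_comp; [exact: fc|exact: cvg_snd].
have lin : {for t, continuous (fun t : R => 2 * pi * t)}.
  by apply: cvgM; [exact: cvg_cst|exact: cvg_id].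
apply: (@pair_continuous R (R * R)%type R) => //.
apply: (@pair_continuous R R R); apply: cvgM => //;
  by apply: continuous_comp; [exact: lin|exact: continuous_sin || exact: continuous_cos].
Qed.

(** * Counting the components of the closure by cycles *)

Lemma card_eq_finset (T : finType) (A : {set T}) : ([set` A] #= `I_#|A|)%card.
Proof.
have [->|[x0 _]] := finset.set_0Vmem A.
  rewrite finset.cards0 II0 card_eq0; apply/eqP.
  by apply/seteqP; split => x //=; rewrite inE.
have -> : [set` A] = nth x0 (enum A) @` `I_#|A|.
  apply/seteqP; split => [x /= xA|_ [i /= iA <-]].
    by exists (index x (enum A)); rewrite /= ?nth_index ?cardE ?index_mem ?mem_enum.
  by rewrite -mem_enum mem_nth // -cardE.
apply: inj_card_eq => i j /set_mem /= + /set_mem /= +; rewrite cardE => iA jA /eqP.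
by rewrite nth_uniq ?enum_uniq // => /eqP.
Qed.

Lemma card_components_closure (R : realType) (p : nat) (A : set (braid_space R))
    (w : 'S_p) : braid_perm A w ->
  (components (braid_closure A) #= `I_#|porbits w|)%card.
Proof.
move=> [f [fc AE fe fi]].
set L := braid_closure A.
pose a j : R -> R * R * R := fun t => close_up (t, f j t).
have ac j : continuous (a j) := close_up_continuous (fc j).
pose arc j := a j @` `[0, 1].
pose K (X : {set 'I_p}) := \bigcup_(j in [set` X]) arc j.
have LE : L = \bigcup_j arc j.
  rewrite /L /braid_closure AE; apply/seteqP; split.
    move=> _ [[t z] /= [t01 [j ->]] <-]; exists j => //.
    by exists t => //; rewrite /= in_itv.
  move=> _ [j _ [t + <-]]; rewrite /= in_itv /= => t01.
  by exists (t, f j t) => //=; split => //; exists j.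
have a0 j : arc j (a j 0) by exists 0 => //=; rewrite in_itv /= lexx ler01.
(* The angles 0 and 2 pi agree, so arc [j] ends where arc [w j] starts. *)
have a1 j : arc j (a (w j) 0).
  exists 1; first by rewrite /= in_itv /= lexx ler01.
  rewrite /a /close_up /= (fe j).2 (fe (w j)).1 /= !mulr0 mulr1.
  by rewrite !(mulr_natl pi 2) cos2pi sin2pi cos0 sin0.
have arcL j : arc j `<=` L by rewrite LE => z; exists j.
have arc_conn j : connected (arc j).
  apply: connected_continuous_connected; first exact: segment_connected.
  exact: continuous_subspaceT.
have Kclosed X : closed (K X).
  apply: closed_bigcup; first exact: finite_finset.
  move=> j _; apply: compact_closed; first exact: norm_hausdorff.
  by apply: continuous_compact; [exact: continuous_subspaceT|exact: segment_compact].
(* A common point occurs either at equal times, forcing [i = j], or where the end of one arc meets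
   the start of the other, so that [w] maps one index to the other. *)
have arc_disj i j z : arc i z -> arc j z -> porbit w i = porbit w j.
  move=> [t]; rewrite /= in_itv /= => t01 <- [u]; rewrite /= in_itv /= => u01.
  have wj k : porbit w (w k) = porbit w k.
    by apply/eqP; rewrite eq_porbit_mem -[w k]/((w ^+ 1)%g k) mem_porbit.
  move/close_up_eq => /= -[//|//|||]; [exact: (fi _ _).2..|].
  move=> E [ut|[[u0 t1]|[u1 t0]]].
  - by rewrite ut in E; rewrite ((fi _ t01).1 _ _ E).
  - by move: E; rewrite u0 t1 (fe j).1 (fe i).2 => /eqn_bullet/val_inj ->.
  - by move: E; rewrite u1 t0 (fe i).1 (fe j).2 => /eqn_bullet/val_inj <-.
have comp_w k j : connected_component L (a j 0) = connected_component L (a ((w ^+ k)%g j) 0).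
  elim: k => [|k ->]; first by rewrite perm1.
  set i := (w ^+ k)%g j; rewrite expgSr permM -/i; apply: same_connected_component.
  exact: (connected_component_max (a0 i) (arcL i) (arc_conn i) (a1 i)).
have compE i z : arc i z -> connected_component L z = K (porbit w i).
  move=> Siz; have -> : connected_component L z = connected_component L (a i 0).
    apply: same_connected_component.
    exact: (connected_component_max Siz (arcL i) (arc_conn i) (a0 i)).
  apply/seteqP; split; last first.
    move=> y [_ /= /porbitP[k ->] Sy]; rewrite (comp_w k).
    exact: (connected_component_max (a0 _) (arcL _) (arc_conn _) Sy).
  set C := connected_component _ _.
  have CL : C `<=` L := @connected_component_sub _ _ _.
  suff <- : C `&` K (porbit w i) = C by move=> y [].
  (* A nonempty part of the connected set [C] that is open and closed in [C] is all of [C]. Openness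
     comes from the closed union of the arcs outside the cycle, which together with [K (porbit w i)]
     covers [L]. *)
  apply: (@component_connected _ L (a i 0)).
  - exists (a i 0); split; first exact: connected_component_refl (arcL i _ (a0 i)).
    by exists i; [exact: porbit_id | exact: a0].
  - exists (~` K (~: porbit w i)); first by apply: closed_openC.
    apply/seteqP; split => y [Cy Ky]; split => //.
      move=> [k /= + Sky]; case: Ky => j /= ji Sjy.
      by rewrite inE -eq_porbit_mem (arc_disj _ _ _ Sky Sjy) eq_porbit_mem ji.
    have := CL _ Cy; rewrite LE => -[j _ Sjy]; exists j => //=.
    by apply/negPn/negP => ji; apply: Ky; exists j => //=; rewrite inE.
  - by exists (K (porbit w i)).
have -> : components L = K @` [set` porbits w].
  apply/seteqP; split => [_ [z + <-]|_ [X /= /imsetP[i _ ->] <-]].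
    rewrite {1}LE => -[i _ Siz]; exists (porbit w i); last by rewrite (compE i).
    by rewrite /= imset_f.
  by exists (a i 0); [exact/arcL/a0 | exact/compE/a0].
apply: card_eq_trans (card_eq_finset (porbits w)).
(* Distinct cycles give distinct components: by [arc_disj], a point of an arc determines its
   cycle. *)
apply: inj_card_eq => X Y /set_mem/imsetP[i _ ->] /set_mem/imsetP[j _ ->] E.
have : K (porbit w j) (a i 0) by rewrite -E; exists i => //=; exact: porbit_id.
move=> [k /= /porbitP[n ->]] /(arc_disj _ _ _ (a0 i)) ->.
by apply/eqP; rewrite eq_porbit_mem mem_porbit.
Qed.

Theorem theorem1p2 (R : realType) (p r : nat) (q s : int)
    (r_gt0 : (0 < r)%N) (r_le_p : (r <= p)%N) :
  exists m : nat, (0 < m)%N /\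
    (components (@twisted_torus_link R p q r s)
      #= `I_(m * gcdn (gcdn p `|q|) (gcdn r `|s|)))%card.
Proof.
case: p r_le_p => [|n] r_le_p; first by move: r_gt0; rewrite lt0n -leqn0 r_le_p.
set d := gcdn _ _.
have d_pq : (d %| gcdn n.+1 `|q|)%N := dvdn_gcdl _ _.
have d_rs : (d %| gcdn r `|s|)%N := dvdn_gcdr _ _.
move: d_pq d_rs; rewrite !dvdn_gcd => /andP[dp dq] /andP[dr ds].
have d_gt0 : (0 < d)%N by rewrite /d !gcdn_gt0.
pose c m : 'S_n.+1 := (\prod_(1 <= i < m) tperm (inord i.-1) (inord i))%g.
pose w := (perm_zpow (c n.+1) q * perm_zpow (c r) s)%g.
have /dvdnP[m wE] : (d %| #|porbits w|)%N.
  apply: dvdn_card_porbits => //; apply: block_permM => //.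
    by apply: (block_perm_zpow d_gt0 _ dp dq) => //; apply: cyclic_decr_prod_tperm; exact: leqnn.
  apply: (block_perm_zpow d_gt0 r_gt0 dr ds).
  by apply: cyclic_decr_prod_tperm; rewrite r_gt0.
exists m; split.
  (* The cycle of strand 0 exists, so the multiplier [m] cannot vanish. *)
  have : (0 < #|porbits w|)%N.
    by apply/card_gt0P; exists (porbit w ord0); apply: imset_f.
  by rewrite wE; case: (m).
rewrite -wE; apply: card_components_closure.
by apply: braid_perm_mul; apply: braid_perm_pow; apply: braid_perm_cycle.
Qed.
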